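(* Let $p$ be a prime, $N=p^e$ with $e\ge1$, let $h\ge1$ be a divisor of $N-1$, put $A=(N-1)/h$ and $\Lambda_{N,h}(U)=U(U^A-1)^h\in\mathbb F_p[U]$. Let $Q=p^m$ with $m\ge1$ and put $s=p^{\gcd(e,m)}$, $C=(N-1)/(s-1)$, $\kappa=\gcd(h,C)$. Assume $Q\ge N$. Then $\Lambda_{N,h}$ is not a permutation polynomial of $\mathbb F_Q$, and its exact defect from the Wan--Shiue--Chen upper bound for non-permutation polynomials of degree $N$ is $$\left(Q-\left\lceil\frac{Q-1}{N}\right\rceil\right)-\#\Lambda_{N,h}(\mathbb F_Q)=\frac{\kappa(s-1)Q}{hs}-\left\lceil\frac{Q-1}{N}\right\rceil.$$ If $\mathbb F_N\subseteq\mathbb F_Q$, then this simplifies to $$\left(Q-\left\lceil\frac{Q-1}{N}\right\rceil\right)-\#\Lambda_{N,h}(\mathbb F_Q)=\frac{Q(N-1-h)}{Nh}.$$ Thus, when $\mathbb F_N\subseteq\mathbb F_Q$, equality $\#\Lambda_{N,h}(\mathbb F_Q)=Q-\lceil (Q-1)/N\rceil$ with the Wan--Shiue--Chen bound holds if and only if $h=N-1$.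
   Context: All finite fields of characteristic $p$ are regarded as subfields of a fixed algebraic closure $\overline{\mathbb F}_p$, so $\mathbb F_N\subseteq\mathbb F_Q$ means $e\mid m$. A polynomial $f\in\mathbb F_Q[U]$ is a permutation polynomial of $\mathbb F_Q$ if it induces a bijection $\mathbb F_Q\to\mathbb F_Q$. $\Lambda_{N,h}(\mathbb F_Q)$ denotes the image of $\Lambda_{N,h}$ on $\mathbb F_Q$. The Wan--Shiue--Chen upper bound is the known inequality $\#f(\mathbb F_Q)\le Q-\lceil (Q-1)/d\rceil$ for a polynomial $f\in\mathbb F_Q[U]$ of degree $d$ that is not a permutation polynomial of $\mathbb F_Q$. *)

(* Defs.v *)
From HB Require Import structures.
From mathcomp Require Import all_boot all_order all_algebra.

Set Implicit Arguments.
Unset Strict Implicit.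
Unset Printing Implicit Defensive.

Import Order.TTheory GRing.Theory Num.Theory.

Local Open Scope ring_scope.

Definition permutation_poly (F : finFieldType) (f : {poly F}) : Prop :=
  bijective (fun x : F => f.[x]).

Definition poly_image (F : finFieldType) (f : {poly F}) : {set F} :=
  [set f.[x] | x : F].

(* The quotient is exact whenever h divides N - 1. *)
Definition Lambda (p N h : nat) : {poly 'F_p} :=
  'X * ('X^((N - 1) %/ h) - 1) ^+ h.

(* Lambda over an extension F of 'F_p; the embedding iota is unique. *)
Definition Lambda_over (p : nat) (F : finFieldType) (iota : {rmorphism 'F_p -> F})
    (N h : nat) : {poly F} :=
  map_poly iota (Lambda p N h).

(* The Wan--Shiue--Chen upper bound on the number of values on a field of Q
   elements of a non-permutation polynomial of degree d. *)
Definition wsc_bound (Q d : nat) : rat :=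
  Q%:R - (Num.ceil ((Q%:R - 1) / d%:R : rat))%:~R.

(* Main.v *)
(* Writing u = y^h, one has Lambda(y^h) = (y^N - y)^h. In a finite extension E
   of F containing enough roots of unity, the nonzero values of Lambda on F are
   therefore the h-th powers of the nonzero elements y^N - y, where y ranges
   over the eigenspaces V_w = {y | y^Q = w y}, w^h = 1, and each value has
   exactly h such roots, lying in various V_w. The additive map y |-> y^N - y
   sends V_w, which has Q elements, to itself. Its kernel has s elements if w is
   the (Q-1)-th power of some y with y^(N-1) = 1, i.e. if w^C = 1, and is trivial
   otherwise. Since w^h = w^C = 1 has kappa solutions, summing |image| - 1 over
   all w gives h (#Lambda(F) - 1) = kappa (Q/s - 1) + (h - kappa) (Q - 1). *)
Require Import Defs.
From HB Require Import structures.
From mathcomp Require Import all_boot all_order all_algebra.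
From mathcomp Require Import all_solvable all_field ring lra.

Set Implicit Arguments.
Unset Strict Implicit.
Unset Printing Implicit Defensive.

Import Order.TTheory GRing.Theory Num.Theory.

Local Open Scope ring_scope.

(** * Preliminaries: gcds of numbers [p ^ k - 1], extensions with roots of unity, fibre counts *)

(** [d] divides [p ^ k - 1] iff [p ^ k = 1] modulo [d]; such exponents [k] are closed under
    multiples and, by a Bezout relation, under gcd. *)
Lemma gcdn_exp_sub1 (p e m : nat) : (0 < p)%N -> (0 < e)%N ->
  gcdn (p ^ e - 1) (p ^ m - 1) = (p ^ gcdn e m - 1)%N.
Proof.
move=> p_gt0 e_gt0.
have p1 k : (1 <= p ^ k)%N by rewrite expn_gt0 p_gt0.
have modP d k : (d %| p ^ k - 1)%N = (p ^ k == 1 %[mod d])%N.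
  by rewrite eqn_mod_dvd.
have mod1X d k l : (p ^ k = 1 %[mod d] -> p ^ (k * l) = 1 %[mod d])%N.
  by move=> h; rewrite expnM -modnXm h modnXm exp1n.
apply/eqP; rewrite eqn_dvd dvdn_gcd !modP; apply/andP; split; last first.
  have h : (p ^ gcdn e m == 1 %[mod p ^ gcdn e m - 1])%N by rewrite -modP.
  have /dvdnP[a ea] := dvdn_gcdl e m; have /dvdnP[b eb] := dvdn_gcdr e m.
  rewrite {1}ea {4}eb !(mulnC _ (gcdn e m)).
  by apply/andP; split; apply/eqP/mod1X/eqP.
set d := gcdn (_ - _) _.
have he : (p ^ e = 1 %[mod d])%N by apply/eqP; rewrite -modP; apply: dvdn_gcdl.
have hm : (p ^ m = 1 %[mod d])%N by apply/eqP; rewrite -modP; apply: dvdn_gcdr.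
have [a b eab _] := egcdnP m e_gt0.
have := mod1X _ _ a he; rewrite mulnC eab mulnC expnD -modnMml (mod1X _ _ _ hm).
by rewrite modnMml mul1n => /eqP.
Qed.

(** ['X^n - 1] is separable because [n] is nonzero in [F]; its [n] distinct roots in a splitting
    field then include a primitive one. *)
Lemma prim_root_extension (F : finFieldType) (n : nat) : (n%:R : F) != 0 ->
  exists (E : finFieldType) (j : {rmorphism F -> E}) (z : E),
    n.-primitive_root z.
Proof.
move=> n_neq0; have n_gt0 : (0 < n)%N by case: n n_neq0; rewrite ?eqxx.
have q_neq0 : 'X^n - 1 != 0 :> {poly F} by rewrite monic_neq0 ?monicXnsubC.
have [L [rs Drs _]] := FinSplittingFieldFor q_neq0.
rewrite rmorphB rmorphXn rmorph1 /= map_polyX in Drs.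
have Urs : uniq rs.
  rewrite -separable.separable_prod_XsubC -(separable.eqp_separable Drs).
  rewrite cyclotomic.separable_Xn_sub_1 //.
  by rewrite -(rmorph_nat (in_alg L)) fmorph_eq0.
have szrs : size rs = n.
  have := eqp_size Drs.
  by rewrite size_prod_XsubC size_XnsubC // => -[].
have /(has_prim_root n_gt0) : all n.-unity_root rs.
  apply/allP => x xrs; rewrite /root_of_unity (eqp_root Drs).
  by rewrite root_prod_XsubC.
rewrite Urs szrs leqnn => /(_ isT isT) /hasP[z _ z_prim].
exists (finvect_type L), (in_alg L), z.
by exact: z_prim.
Qed.

Lemma card_fibers (aT rT : finType) (f : aT -> rT) (A : {set aT}) (k : nat) :
  {in A, forall x, #|[set y in A | f y == f x]| = k} ->
  #|A| = (#|f @: A| * k)%N.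
Proof.
move=> fib; rewrite -sum1_card (partition_big_imset f) /= -sum_nat_const.
apply: eq_bigr => _ /imsetP[x xA ->]; rewrite sum1dep_card -(fib x xA).
by apply: eq_card => y; rewrite !inE.
Qed.

(** * Roots of unity and power maps *)

Section RootsOfUnity.
Variables (E : finFieldType) (n : nat) (z : E).
Hypothesis z_prim : n.-primitive_root z.

(** With [x = z ^+ i], the hypothesis says that [n] divides [i * (n %/ d)], that is, [d] divides
    [i]. *)
Lemma unity_root_is_power (d : nat) (x : E) :
  (d %| n)%N -> x ^+ (n %/ d) = 1 -> exists y, x = y ^+ d.
Proof.
move=> d_dvd xd1; have n_gt0 := prim_order_gt0 z_prim.
have d_gt0 := dvdn_gt0 n_gt0 d_dvd.
have nd_gt0 : (0 < n %/ d)%N by rewrite divn_gt0 // dvdn_leq.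
have /(prim_rootP z_prim)[i xi] : x ^+ n = 1.
  by rewrite -(divnK d_dvd) exprM xd1 expr1n.
have : (d * (n %/ d) %| i * (n %/ d))%N.
  by rewrite mulnC divnK // (prim_order_dvd z_prim) exprM -xi xd1.
rewrite dvdn_pmul2r // => /dvdnP[k ik].
by exists (z ^+ k); rewrite xi ik exprM.
Qed.

Lemma card_unity_roots (d : nat) :
  (d %| n)%N -> #|[set x : E | x ^+ d == 1]| = d.
Proof.
move=> d_dvd; have w_prim := dvdn_prim_root z_prim d_dvd.
set w := z ^+ _ in w_prim.
have -> : [set x : E | x ^+ d == 1] = [set w ^+ (i : 'I_d) | i in 'I_d].
  apply/setP => x; rewrite inE; apply/eqP/imsetP.
    by case/(prim_rootP w_prim) => i ->; exists i.
  by case=> i _ ->; rewrite exprAC (prim_expr_order w_prim) expr1n.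
rewrite card_imset ?card_ord // => i j /eqP.
by rewrite (eq_prim_root_expr w_prim) !modn_small // => /eqP/val_inj.
Qed.

(** [A] is the coset of [b] under the [d]-th roots of unity. This form serves both fibres of power
    maps and the nonzero kernel elements of [y^N - y]. *)
Lemma card_unity_coset (d : nat) (A : {set E}) (b : E) : (d %| n)%N ->
  b != 0 -> b \in A -> {in A, forall x, (x / b) ^+ d = 1} ->
  (forall c, c ^+ d = 1 -> b * c \in A) -> #|A| = d.
Proof.
move=> d_dvd b0 bA Ab bcA; rewrite -[RHS](card_unity_roots d_dvd).
have -> : A = [set b * c | c in [set x : E | x ^+ d == 1]].
  apply/setP => x; apply/idP/imsetP => [xA | [c]].
    by exists (x / b); rewrite ?inE ?Ab // mulrC divfK.
  by rewrite inE => /eqP/bcA bc ->.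
by rewrite card_imset //; apply: mulfI.
Qed.

Lemma card_power_fiber (d : nat) (a : E) : (d %| n)%N ->
  a ^+ (n %/ d) = 1 -> #|[set x : E | x ^+ d == a]| = d.
Proof.
move=> d_dvd ad1; have [b ab] := unity_root_is_power d_dvd ad1.
have n_gt0 := prim_order_gt0 z_prim.
have b0 : b != 0.
  have nd0 : (0 < n %/ d)%N by rewrite divn_gt0 ?(dvdn_gt0 n_gt0) // dvdn_leq.
  have d0 := dvdn_gt0 n_gt0 d_dvd.
  apply: contra_eq_neq ad1 => b0; rewrite ab b0 expr0n gtn_eqF // expr0n.
  by rewrite gtn_eqF // eq_sym oner_eq0.
apply: (@card_unity_coset d _ b) => //; first by rewrite inE ab.
- move=> x; rewrite inE => /eqP xa; rewrite expr_div_n xa -ab divff //.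
  by rewrite ab expf_neq0.
- by move=> c c1; rewrite inE exprMn c1 mulr1 ab.
Qed.

End RootsOfUnity.

Lemma expr_gcdn_eq1 (R : nzRingType) (x : R) (a b : nat) : (0 < a)%N ->
  x ^+ a = 1 -> x ^+ b = 1 -> x ^+ gcdn a b = 1.
Proof.
move=> a_gt0 xa xb; have [k l eab _] := egcdnP b a_gt0.
have := congr1 (fun i => x ^+ i) eab.
by rewrite mulnC exprM xa expr1n exprD mulnC exprM xb expr1n mul1r.
Qed.

(** * The additive map [y^N - y] on eigenspaces of the [Q]-Frobenius *)

Section TwistedArtinSchreier.

Variables (E : finFieldType) (p e m h : nat).
Let N := (p ^ e)%N.
Let Q := (p ^ m)%N.
Let s := (p ^ gcdn e m)%N.
Let C := ((N - 1) %/ (s - 1))%N.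

Hypothesis pcharE : p \in [pchar E].
Hypotheses (e_gt0 : (0 < e)%N) (m_gt0 : (0 < m)%N).
Hypothesis h_dvd : (h %| N - 1)%N.

(** If [w^h = 1], a nonzero [y] with [y^Q = w y] is an [h (Q - 1)]-th root of unity; the two
    divisibilities make [E] contain all of these and all of the field of [N] elements. *)
Variables (n : nat) (z : E).
Hypothesis z_prim : n.-primitive_root z.
Hypotheses (hQ_dvd : (h * (Q - 1) %| n)%N) (N_dvd : (N - 1 %| n)%N).

Implicit Types (t u v w x y : E).

Definition artin_schreier (y : E) : E := y ^+ N - y.
Definition frob_eigenspace (w : E) : {set E} := [set y : E | y ^+ Q == w * y].
Definition lambda_fun (u : E) : E := u * (u ^+ ((N - 1) %/ h) - 1) ^+ h.
(** Eigenvalue 1 singles out the subfield of [Q] elements, so this is the copy in [E] of the image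
    to be counted. *)
Definition lambda_values : {set E} := lambda_fun @: frob_eigenspace 1.

Let p_gt1 : (1 < p)%N.
Proof. exact/prime_gt1/pcharf_prime/pcharE. Qed.

Let p_gt0 : (0 < p)%N.
Proof. exact: ltnW. Qed.

Let N_gt1 : (1 < N)%N.
Proof. by rewrite -(exp1n e) ltn_exp2r. Qed.

Let Q_gt1 : (1 < Q)%N.
Proof. by rewrite -(exp1n m) ltn_exp2r. Qed.

Let s_gt1 : (1 < s)%N.
Proof. by rewrite -(exp1n (gcdn e m)) ltn_exp2r // gcdn_gt0 e_gt0. Qed.

Let N_sub1 : (N - 1).+1 = N.
Proof. by rewrite subn1 prednK // ltnW. Qed.

Let Q_sub1 : (Q - 1).+1 = Q.
Proof. by rewrite subn1 prednK // ltnW. Qed.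

Let s_sub1 : (s - 1).+1 = s.
Proof. by rewrite subn1 prednK // ltnW. Qed.

Let gcdNQ : gcdn (N - 1) (Q - 1) = (s - 1)%N.
Proof. exact: gcdn_exp_sub1. Qed.

Let h_gt0 : (0 < h)%N.
Proof. by apply: dvdn_gt0 h_dvd; rewrite subn_gt0. Qed.

Let s_sub1_dvd : (s - 1 %| N - 1)%N.
Proof. by rewrite -gcdNQ dvdn_gcdl. Qed.

Let h_dvdn : (h %| n)%N.
Proof. exact: dvdn_trans h_dvd N_dvd. Qed.

Let Q_dvdn : (Q - 1 %| n)%N.
Proof. exact: dvdn_trans (dvdn_mull _ _) hQ_dvd. Qed.

Let expr0Q : 0 ^+ Q = 0 :> E.
Proof. by rewrite -Q_sub1 expr0n. Qed.

Let AS_0 : artin_schreier 0 = 0.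
Proof. by rewrite /artin_schreier subr0 -N_sub1 expr0n. Qed.

Let unity_neq0 k x : (0 < k)%N -> x ^+ k = 1 -> x != 0.
Proof.
move=> k_gt0; apply: contra_eq_neq => ->.
by rewrite expr0n gtn_eqF // eq_sym oner_eq0.
Qed.

Let frobB k x y : (x - y) ^+ (p ^ k) = x ^+ (p ^ k) - y ^+ (p ^ k).
Proof.
elim: k x y => // k IHk x y.
by rewrite expnSr !exprM IHk -!(pFrobenius_autE pcharE) rmorphB.
Qed.

(** As [h] divides [N - 1], the [h]-th roots of unity lie in the field of [N] elements; hence
    [y^N - y] is linear under scaling by them. *)
Let unity_N w : w ^+ h = 1 -> w ^+ N = w.
Proof.
move=> w1; rewrite -N_sub1 exprS -(divnK h_dvd) mulnC exprM w1 expr1n.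
by rewrite mulr1.
Qed.

Let eigen_exp w y : y != 0 -> (y ^+ Q == w * y) = (y ^+ (Q - 1) == w).
Proof. by move=> y0; rewrite -{1}Q_sub1 exprSr (inj_eq (mulIf y0)). Qed.

Lemma artin_schreier_eigen w y : w ^+ h = 1 ->
  y \in frob_eigenspace w -> artin_schreier y \in frob_eigenspace w.
Proof.
rewrite !inE /artin_schreier => w1 /eqP yw.
by rewrite frobB exprAC yw exprMn (unity_N w1) mulrBr.
Qed.

Lemma artin_schreierB x y :
  artin_schreier (x - y) = artin_schreier x - artin_schreier y.
Proof. by rewrite /artin_schreier frobB !opprD !opprK addrACA. Qed.

Lemma lambda_fun_exp y : lambda_fun (y ^+ h) = artin_schreier y ^+ h.
Proof.
rewrite /lambda_fun -exprM mulnC divnK // -exprMn /artin_schreier.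
by rewrite mulrBr mulr1 -exprS N_sub1.
Qed.

Lemma card_frob_eigenspace w : w ^+ h = 1 -> #|frob_eigenspace w| = Q.
Proof.
move=> w1; have -> : frob_eigenspace w = 0 |: [set y | y ^+ (Q - 1) == w].
  apply/setP => y; rewrite !inE.
  have [->|y0] := eqVneq y 0; last exact: eigen_exp.
  by rewrite expr0Q mulr0 eqxx.
rewrite cardsU1 !inE (card_power_fiber z_prim) //; last first.
  (* [n %/ (Q - 1)] is a multiple of [h], so it kills [w], which is thus a [(Q - 1)]-th power. *)
  have /dvdnP[k ->] := hQ_dvd.
  by rewrite mulnA mulnK ?subn_gt0 // mulnC exprM w1 expr1n.
rewrite expr0n gtn_eqF ?subn_gt0 // (_ : _ == w = false) ?add1n //.
by apply: contra_eqF w1 => /eqP <-; rewrite expr0n gtn_eqF // eq_sym oner_eq0.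
Qed.

(** In the cyclic group of order [N - 1], the [(Q - 1)]-th powers form the subgroup of index
    [gcd(N - 1, Q - 1) = s - 1], hence of order [C]. *)
Lemma frobenius_ratioP w : w ^+ C = 1 <->
  exists2 y, y ^+ (N - 1) = 1 & y ^+ (Q - 1) = w.
Proof.
split=> [wC|[y yN <-]]; last first.
  have /dvdnP[k ->] : (s - 1 %| Q - 1)%N by rewrite -gcdNQ dvdn_gcdr.
  by rewrite -exprM -mulnA [(_ * C)%N]mulnC divnK // mulnC exprM yN expr1n.
have [x xw] : exists x, w = x ^+ (s - 1).
  apply: (unity_root_is_power z_prim); first exact: dvdn_trans N_dvd.
  have /dvdnP[k ->] := N_dvd.
  by rewrite -muln_divA // mulnC exprM wC expr1n.
have xN : x ^+ (N - 1) = 1.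
  by rewrite -(divnK s_sub1_dvd) mulnC exprM -xw.
have Q1_gt0 : (0 < Q - 1)%N by rewrite subn_gt0.
(* Bezout: [a (Q - 1) = b (N - 1) + (s - 1)], so the [(Q - 1)]-th power of [x ^+ a] is
   [x ^+ (s - 1) = w]. *)
have [a b eab _] := egcdnP (N - 1) Q1_gt0.
exists (x ^+ a); first by rewrite exprAC xN expr1n.
rewrite -exprM eab exprD mulnC exprM xN expr1n mul1r xw.
by rewrite gcdnC gcdNQ.
Qed.


(** Nonzero kernel elements satisfy [y^(N-1) = 1] and [y^(Q-1) = w]. If any exists, the ratios of
    two of them are exactly the [(s - 1)]-th roots of unity. *)
Lemma card_artin_schreier_kernel w : w ^+ h = 1 ->
  #|[set y in frob_eigenspace w | artin_schreier y == 0]|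
    = (if w ^+ C == 1%R then s else 1)%N.
Proof.
move=> w1; set K := [set y in _ | _].
pose K1 := [set y : E | (y ^+ (N - 1) == 1) && (y ^+ (Q - 1) == w)].
have -> : K = 0 |: K1.
  apply/setP => y; rewrite !inE; have [->|y0] := eqVneq y 0.
    by rewrite AS_0 expr0Q mulr0 !eqxx.
  rewrite eigen_exp // andbC /artin_schreier subr_eq0 -{1}N_sub1 exprS.
  by rewrite -[X in _ == X]mulr1 (inj_eq (mulfI y0)).
have K1_0 : 0 \notin K1.
  by rewrite inE expr0n gtn_eqF ?subn_gt0 // eq_sym oner_eq0.
rewrite cardsU1 K1_0; case: eqP => [/frobenius_ratioP[b bN bQ]|wC]; last first.
  rewrite (_ : K1 = set0) ?cards0 //; apply/setP => y; rewrite !inE.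
  by apply/andP => -[/eqP yN /eqP yQ]; apply/wC/frobenius_ratioP; exists y.
have bK1 : b \in K1 by rewrite inE bN bQ !eqxx.
rewrite (card_unity_coset z_prim (d := s - 1) _ _ bK1) ?add1n //.
- exact: dvdn_trans N_dvd.
- by apply: contraNneq K1_0 => <-.
- move=> x; rewrite inE => /andP[/eqP xN /eqP xQ].
  rewrite -gcdNQ; apply: expr_gcdn_eq1; first by rewrite subn_gt0.
    by rewrite expr_div_n xN bN divr1.
  rewrite expr_div_n xQ bQ divff //.
  exact: unity_neq0 w1.
- move=> c c1; rewrite inE !exprMn bN bQ.
  have /dvdnP[k ->] : (s - 1 %| Q - 1)%N by rewrite -gcdNQ dvdn_gcdr.
  rewrite -(divnK s_sub1_dvd) ![(_ * (s - 1))%N]mulnC !exprM c1 !expr1n !mulr1.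
  by rewrite !eqxx.
Qed.

(** The fibres of the additive map are translates of its kernel. *)
Lemma card_artin_schreier_image w : w ^+ h = 1 ->
  (#|artin_schreier @: frob_eigenspace w| * (if w ^+ C == 1%R then s else 1)
    = Q)%N.
Proof.
move=> w1; rewrite -[RHS](card_frob_eigenspace w1).
symmetry; apply: card_fibers => x xV.
rewrite -(card_artin_schreier_kernel w1) -[RHS](card_imset _ (addrI x)).
have VB y y' : y \in frob_eigenspace w -> y' \in frob_eigenspace w ->
    y - y' \in frob_eigenspace w.
  by rewrite !inE frobB => /eqP-> /eqP->; rewrite mulrBr.
apply: eq_card => y; apply/idP/imsetP => [|[k]]; rewrite !inE.
  move=> /andP[yV /eqP yx]; exists (y - x); last by rewrite addrC subrK.
  rewrite inE VB ?inE //; last by move: xV; rewrite inE.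
  by rewrite artin_schreierB yx subrr eqxx.
(* [VB] gives closure under subtraction, so [x + k] is read as [x - (0 - k)]. *)
move=> /andP[kV /eqP k0] ->; rewrite -[k]opprK -[- k]add0r.
have NkV : 0 - k \in frob_eigenspace w.
  by apply: VB; rewrite inE // expr0Q mulr0.
have := VB _ _ xV NkV; rewrite inE => -> /=.
by rewrite !artin_schreierB k0 AS_0 !subr0 eqxx.
Qed.

(** * Values of Lambda and their [h]-th roots *)

Lemma lambda_values_fixed v : v \in lambda_values -> v ^+ Q = v.
Proof.
case/imsetP=> u; rewrite inE mul1r => /eqP uQ ->.
by rewrite /lambda_fun exprMn uQ exprAC frobB expr1n exprAC uQ.
Qed.

Lemma lambda_values0 : 0 \in lambda_values.
Proof.
apply/imsetP; exists 0; last by rewrite /lambda_fun mul0r.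
by rewrite inE mul1r expr0Q.
Qed.

Lemma fixed_exp_sub1 v : v != 0 -> v ^+ Q = v -> v ^+ (Q - 1) = 1.
Proof. by move=> v0 vQ; apply/eqP; rewrite -eigen_exp // mul1r vQ. Qed.

(** [v] is a [(Q - 1)]-th root of unity, and [Q - 1] divides [n %/ h]. This permits the substitution
    [u = y^h]. *)
Lemma fixed_is_power v : v != 0 -> v ^+ Q = v -> exists y, v = y ^+ h.
Proof.
move=> v0 vQ; apply: (unity_root_is_power z_prim) => //.
have /dvdnP[k ->] := hQ_dvd.
by rewrite mulnCA mulKn // mulnC exprM fixed_exp_sub1 // expr1n.
Qed.

(** The values all lie in the eigenspace of 1; their [h]-th roots are counted instead because these
    spread over the eigenvalues [w = t^(Q-1)]. *)
Let T := [set t : E | (t != 0) && (t ^+ h \in lambda_values)].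

Lemma card_lambda_values_roots : #|T| = (#|lambda_values :\ 0%R| * h)%N.
Proof.
have -> : lambda_values :\ 0 = (fun t => t ^+ h) @: T.
  apply/setP => v; rewrite in_setD1; apply/andP/imsetP => [[v0 vI]|[t]].
    have [t vt] := fixed_is_power v0 (lambda_values_fixed vI).
    exists t => //; rewrite inE -vt vI andbT.
    by apply: contraNneq v0 => t0; rewrite vt t0 expr0n gtn_eqF.
  by rewrite inE => /andP[t0 tI] ->; rewrite expf_neq0.
apply: card_fibers => t tT; have := tT; rewrite inE => /andP[t0 tI].
apply: (card_unity_coset z_prim (b := t)) => //.
- by rewrite inE tT eqxx.
- by move=> x /setIdP[_ /eqP xt]; rewrite expr_div_n xt divff ?expf_neq0.
move=> c c1; rewrite !inE exprMn c1 mulr1 tI eqxx mulf_neq0 //.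
exact: unity_neq0 c1.
Qed.

(* If t^h = Lambda(y^h) then t = c (y^N - y) with c^h = 1; as h divides N - 1,
   c^N = c, so t = (c y)^N - c y. *)
Lemma lambda_values_rootP w t : w ^+ h = 1 ->
  ((t \in T) && (t ^+ (Q - 1) == w))
    = (t \in (artin_schreier @: frob_eigenspace w) :\ 0%R).
Proof.
move=> w1; rewrite in_setD1 inE; have [->//|t0] := eqVneq t 0.
rewrite /= -eigen_exp //; apply/andP/imsetP => [[tI tw]|[y yV ty]]; last first.
  have := artin_schreier_eigen w1 yV; rewrite -ty inE => ->; split=> //.
  rewrite ty -lambda_fun_exp imset_f // inE mul1r exprAC.
  by move: yV; rewrite inE => /eqP->; rewrite exprMn w1 mul1r.
have /imsetP[u] := tI; rewrite inE mul1r => /eqP uQ tu.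
have u0 : u != 0.
  by apply: contra_neq (expf_neq0 h t0) => u0; rewrite tu /lambda_fun u0 mul0r.
have [y uy] := fixed_is_power u0 uQ.
rewrite uy lambda_fun_exp in tu.
have f0 : artin_schreier y != 0.
  by apply: contra_neq (expf_neq0 h t0) => f0; rewrite tu f0 expr0n gtn_eqF.
pose c := t / artin_schreier y.
have c1 : c ^+ h = 1 by rewrite expr_div_n tu divff // expf_neq0.
have tcy : t = artin_schreier (c * y).
  by rewrite /artin_schreier exprMn (unity_N c1) -mulrBr divfK.
have cy0 : c * y != 0.
  by apply: contra_neq t0 => cy0; rewrite tcy cy0 AS_0.
(* [c * y] lies in the eigenspace of some [w'], and so does its image [t]; as [t] is nonzero, it has
   only one eigenvalue, whence [w' = w]. *)
exists (c * y) => //; pose w' := (c * y) ^+ (Q - 1).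
have w'1 : w' ^+ h = 1.
  by rewrite /w' exprAC exprMn c1 mul1r -uy fixed_exp_sub1.
have cyV : c * y \in frob_eigenspace w' by rewrite inE eigen_exp.
have := artin_schreier_eigen w'1 cyV; rewrite -tcy inE (eqP tw).
by move=> /eqP/(mulIf t0) ->.
Qed.

(** [T] is partitioned by [w = t^(Q-1)]. The part at [w] falls short of [Q - 1] by [Q - Q/s] when
    [w^C = 1] and by nothing otherwise. *)
Lemma card_lambda_values :
  (h * #|lambda_values| + gcdn h C * (Q - Q %/ s) = h * Q)%N.
Proof.
have cardU d : (d %| N - 1)%N -> #|[set w : E | w ^+ d == 1]| = d.
  by move=> d_dvd; apply: (card_unity_roots z_prim); apply: dvdn_trans N_dvd.
have T_eq : #|T| = (\sum_(w in [set w : E | w ^+ h == 1%R])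
    #|(artin_schreier @: frob_eigenspace w) :\ 0%R|)%N.
  rewrite -sum1_card.
  rewrite (partition_big (fun t => t ^+ (Q - 1))
    (mem [set w : E | w ^+ h == 1%R])).
    apply: eq_bigr => w; rewrite !inE => /eqP w1; rewrite -sum1_card.
    by apply: eq_bigl => t; apply: lambda_values_rootP.
  move=> t; rewrite !inE => /andP[t0 tI]; rewrite -exprM mulnC exprM.
  by rewrite fixed_exp_sub1 ?expf_neq0 // lambda_values_fixed.
have AS0 w : 0 \in artin_schreier @: frob_eigenspace w.
  by apply/imsetP; exists 0; rewrite ?AS_0 // inE expr0Q mulr0.
have sum_eq : (#|T| + gcdn h C * (Q - Q %/ s) = h * (Q - 1))%N.
  (* Both [h] and [gcdn h C] become numbers of roots of unity, so that the identity can be checked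
     term by term over [w]. *)
  rewrite -{2}(cardU h) // -[in LHS](cardU (gcdn h C)); last first.
    exact: dvdn_trans (dvdn_gcdl _ _) h_dvd.
  have -> : [set w : E | w ^+ gcdn h C == 1] =
      [set w in [set w : E | w ^+ h == 1] | w ^+ C == 1].
    apply/setP => w; rewrite !inE.
    apply/idP/andP => [/eqP w1|[/eqP wh /eqP wC]].
      have w1d d : (gcdn h C %| d)%N -> w ^+ d == 1.
        by case/dvdnP=> k ->; rewrite mulnC exprM w1 expr1n.
      by rewrite !w1d ?dvdn_gcdl ?dvdn_gcdr.
    by apply/eqP/expr_gcdn_eq1.
  rewrite T_eq -!sum_nat_const [X in (_ + X)%N](eq_bigl (fun w =>
    (w \in [set w : E | w ^+ h == 1]) && (w ^+ C == 1))); last first.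
    by move=> w; rewrite !inE.
  rewrite big_mkcondr -big_split; apply: eq_bigr => w /=.
  rewrite inE => /eqP w1; have := card_artin_schreier_image w1.
  rewrite (cardsD1 0 (artin_schreier @: _)) AS0.
  case: ifP => _ <-; last by rewrite addn0 muln1 add1n subn1.
  rewrite mulnK; last exact: ltnW.
  rewrite addnBA; last by rewrite leq_pmulr // ltnW.
  by rewrite addnC subnDr.
(* The value 0, excluded from [T], adds [h] to both sides and turns [h (Q - 1)] into [h Q]. *)
move: sum_eq; rewrite card_lambda_values_roots [in #|lambda_values|](cardsD1 0).
rewrite lambda_values0 mulnDr muln1 -addnA mulnC => ->.
by rewrite -mulnS Q_sub1.
Qed.

End TwistedArtinSchreier.

(** * From the count in [E] back to the polynomial over [F] *)

Lemma horner_Lambda_over (p N h : nat) (F : finFieldType)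
    (iota : {rmorphism 'F_p -> F}) (x : F) :
  (Lambda_over iota N h).[x] = x * (x ^+ ((N - 1) %/ h) - 1) ^+ h.
Proof.
rewrite /Lambda_over /Lambda rmorphM rmorphXn rmorphB rmorphXn rmorph1 /=.
by rewrite map_polyX !hornerE.
Qed.

Lemma size_Lambda_over (p N h : nat) (F : finFieldType)
    (iota : {rmorphism 'F_p -> F}) :
  (1 < N)%N -> (h %| N - 1)%N -> size (Lambda_over iota N h) = N.+1.
Proof.
move=> N_gt1 h_dvd; have N1_gt0 : (0 < N - 1)%N by rewrite subn_gt0.
have A_gt0 : (0 < (N - 1) %/ h)%N.
  by rewrite divn_gt0 ?(dvdn_gt0 N1_gt0) // dvdn_leq.
have q_neq0 : ('X^((N - 1) %/ h) - 1) ^+ h != 0 :> {poly 'F_p}.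
  by rewrite expf_neq0 // monic_neq0 // monicXnsubC.
rewrite size_map_poly /Lambda mulrC size_mulX //.
rewrite -[size _]prednK ?size_poly_gt0 //.
by rewrite size_exp size_XnsubC //= divnK // subn1 prednK // ltnW.
Qed.

Lemma card_poly_image_Lambda (p e h m : nat) (F : finFieldType)
    (iota : {rmorphism 'F_p -> F}) :
  prime p -> (0 < e)%N -> (0 < m)%N -> (h %| p ^ e - 1)%N ->
  #|F| = (p ^ m)%N ->
  let s := (p ^ gcdn e m)%N in
  (h * #|poly_image (Lambda_over iota (p ^ e) h)|
     + gcdn h ((p ^ e - 1) %/ (s - 1)) * (p ^ m - p ^ m %/ s) = h * p ^ m)%N.
Proof.
move=> p_prime e_gt0 m_gt0 h_dvd card_F s.
have pcharF := card_finPcharP card_F p_prime.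
have p_ndvd k : (0 < k)%N -> ~~ (p %| p ^ k - 1)%N.
  move=> k_gt0; rewrite dvdn_subr ?dvdn_exp ?expn_gt0 ?(prime_gt0 p_prime) //.
  by rewrite gtnNdvd // prime_gt1.
(* This [n] is prime to [p], since [p^k - 1] is -1 modulo [p] and [h] divides [p^e - 1]; a primitive
   [n]-th root thus exists in some extension. *)
pose n := (h * (p ^ m - 1) * (p ^ e - 1))%N.
have n_neq0 : n%:R != 0 :> F.
  rewrite -(dvdn_pcharf pcharF) !Euclid_dvdM // !negb_or !p_ndvd // !andbT.
  by apply: contra (p_ndvd e e_gt0) => /dvdn_trans; apply.
have [E [j [z z_prim]]] := prim_root_extension n_neq0.
have pcharE : p \in [pchar E] by rewrite (fmorph_pchar j).
have hQ_dvd : (h * (p ^ m - 1) %| n)%N by rewrite dvdn_mulr.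
have N_dvd : (p ^ e - 1 %| n)%N by rewrite dvdn_mull.
rewrite -(card_lambda_values pcharE e_gt0 m_gt0 h_dvd z_prim hQ_dvd N_dvd).
congr (_ * _ + _)%N.
(* The inclusion of [j(F)] in the fixed points is an equality because both have [p^m] elements. *)
have fixed_im : frob_eigenspace p m 1 = j @: [set: F].
  apply/esym/eqP; rewrite eqEcard; apply/andP; split.
    apply/subsetP => _ /imsetP[x _ ->].
    by rewrite inE mul1r -card_F -rmorphXn /= expf_card.
  rewrite (card_frob_eigenspace (e := e) (h := h) pcharE _ _ _ z_prim)
    ?expr1n //.
  by rewrite card_imset ?cardsT ?card_F //; apply: fmorph_inj.
rewrite /lambda_values fixed_im -(card_imset _ (fmorph_inj j)).
congr #|pred_of_set _|; rewrite /poly_image -!imset_comp.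
have lambdaE x : j (Lambda_over iota (p ^ e) h).[x] = lambda_fun p e h (j x).
  rewrite horner_Lambda_over /lambda_fun.
  by rewrite rmorphM rmorphXn rmorphB rmorphXn rmorph1.
by apply/setP => v; apply/imsetP/imsetP => -[x _ ->]; exists x;
  rewrite /= ?lambdaE.
Qed.

(** * The defect computed in the rationals, and its vanishing *)

Theorem theorem5p5 (p e h m : nat)
    (p_prime : prime p) (e_ge1 : (1 <= e)%N)
    (h_ge1 : (1 <= h)%N) (h_dvd : (h %| p ^ e - 1)%N)
    (m_ge1 : (1 <= m)%N) (Q_ge_N : (p ^ e <= p ^ m)%N)
    (F : finFieldType) (card_F : #|F| = (p ^ m)%N)
    (iota : {rmorphism 'F_p -> F}) :
  let N := (p ^ e)%N in
  let Q := (p ^ m)%N in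
  let s := (p ^ gcdn e m)%N in
  let C := ((N - 1) %/ (s - 1))%N in
  let kappa := gcdn h C in
  let L := Lambda_over iota N h in
  [/\ size L = N.+1,
      ~ permutation_poly L,
      wsc_bound Q N - #|poly_image L|%:R
        = kappa%:R * (s%:R - 1) * Q%:R / (h%:R * s%:R)
          - (Num.ceil ((Q%:R - 1) / N%:R : rat))%:~R,
      (e %| m)%N ->
        wsc_bound Q N - #|poly_image L|%:R
          = Q%:R * (N%:R - 1 - h%:R) / (N%:R * h%:R)
    & (e %| m)%N ->
        (#|poly_image L|%:R = wsc_bound Q N <-> h = (N - 1)%N)].
Proof.
move=> N Q s C kappa L.
have p_gt1 := prime_gt1 p_prime.
have exp_gt1 k : (0 < k)%N -> (1 < p ^ k)%N.
  by move=> k_gt0; rewrite -(exp1n k) ltn_exp2r.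
have N_gt1 : (1 < N)%N by apply: exp_gt1.
have Q_gt1 : (1 < Q)%N by apply: exp_gt1.
have s_gt1 : (1 < s)%N by rewrite exp_gt1 // gcdn_gt0 e_ge1.
have s_dvdQ : (s %| Q)%N by rewrite dvdn_exp2l // dvdn_leq // dvdn_gcdr.
have kappa_gt0 : (0 < kappa)%N by rewrite gcdn_gt0 h_ge1.
have count := card_poly_image_Lambda iota p_prime e_ge1 m_ge1 h_dvd card_F.
rewrite /= -/N -/Q -/s -/C -/kappa -/L in count.
have Qs_lt : (Q %/ s < Q)%N by rewrite ltn_Pdiv // ltnW.
have h0 : h%:R != 0 :> rat by rewrite pnatr_eq0 -lt0n.
have s0 : s%:R != 0 :> rat by rewrite pnatr_eq0 -lt0n ltnW.
have N0 : N%:R != 0 :> rat by rewrite pnatr_eq0 -lt0n ltnW.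
have Q0 : Q%:R != 0 :> rat by rewrite pnatr_eq0 -lt0n ltnW.
have defect : wsc_bound Q N - #|poly_image L|%:R
        = kappa%:R * (s%:R - 1) * Q%:R / (h%:R * s%:R)
          - (Num.ceil ((Q%:R - 1) / N%:R : rat))%:~R.
  have QE : Q%:R = (Q %/ s)%:R * s%:R :> rat by rewrite -natrM divnK.
  have := congr1 (fun k => k%:R : rat) count.
  rewrite /wsc_bound natrD !natrM natrB ?(ltnW Qs_lt) //.
  (* The ceiling occurs identically on both sides and becomes an atom; with [Q = r s] the count is
     solved for the image size [I]. *)
  move: (Num.ceil _)%:~R => c; rewrite QE.
  move: (_ %/ _)%:R #|_|%:R => r I eqI.
  have -> : I = (h%:R * (r * s%:R) - kappa%:R * (r * s%:R - r)) / h%:R.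
    by rewrite -eqI; field.
  by field; rewrite h0 s0.
have defect_sub : (e %| m)%N -> wsc_bound Q N - #|poly_image L|%:R
          = Q%:R * (N%:R - 1 - h%:R) / (N%:R * h%:R).
  move=> e_dvd; have sN : s = N by rewrite /s (gcdn_idPl e_dvd).
  have C1 : C = 1%N by rewrite /C sN divnn subn_gt0 N_gt1.
  have N_dvdQ : (N %| Q)%N by rewrite dvdn_exp2l // dvdn_leq.
  (* As [N] divides [Q] and [0 < 1/N < 1], the number [Q/N - 1/N] rounds up to [Q/N]. *)
  have ceilE : Num.ceil ((Q%:R - 1) / N%:R : rat) = (Q %/ N)%:Z.
    apply: Num.Theory.ceil_def; rewrite -[in Q%:R](divnK N_dvdQ) natrM.
    have N_gt0 : 0 < N%:R :> rat by rewrite ltr0n ltnW.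
    have N_gt1R : 1 < N%:R :> rat by rewrite ltr1n.
    rewrite intrB ltr_pdivlMr // ler_pdivrMr //=.
    rewrite -pmulrn; apply/andP; split; nra.
  rewrite defect ceilE /kappa C1 gcdn1 sN -pmulrn.
  by rewrite -[in Q%:R](divnK N_dvdQ) natrM; field; rewrite h0 N0.
split=> //.
- exact: size_Lambda_over.
(* A bijection would have [Q] values, and the count would force [kappa (Q - Q/s) = 0], though both
   factors are positive. *)
- move=> perm_L; have im_L : #|poly_image L| = Q.
    by rewrite card_imset ?card_F //; apply: bij_inj.
  move: count => /eqP; rewrite im_L -[X in _ == X]addn0 eqn_add2l muln_eq0.
  by rewrite subn_eq0 leqNgt Qs_lt orbF gtn_eqF.
move=> e_dvd; have D := defect_sub e_dvd.
have N1E : (N - 1)%:R = N%:R - 1 :> rat by rewrite natrB // ltnW.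
split=> [im_eq|h_eq].
  (* Zero defect leaves [N - 1 - h = 0], the other factors being nonzero. *)
  move: D; rewrite im_eq subrr => /esym/eqP.
  rewrite !mulf_eq0 invr_eq0 mulf_eq0 (negPf Q0) (negPf N0) (negPf h0) !orbF /=.
  by rewrite -N1E subr_eq0 eqr_nat => /eqP.
by apply/esym/eqP; rewrite -subr_eq0 D h_eq -N1E subrr mulr0 mul0r.
Qed.
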